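(* Let $\lambda>0$, $Q\in\{5,9\}$, and let $c_0,\dots,c_{Q-1}\in\mathbb{R}^2$ be the D2Q5 speeds (if $Q=5$) or the D2Q9 speeds (if $Q=9$). Let $\Omega_0,\dots,\Omega_{Q-1}\in\mathbb{R}^{3\times3}$ be symmetric positive matrices with $\sum_\zeta\Omega_\zeta=I$ satisfying $$\Omega_\zeta=R_{\pi/2}^{\zeta-1}\,\Omega_1\,R_{-\pi/2}^{\zeta-1}\quad(\zeta\in\{2,3,4\})$$ and, when $Q=9$, $$\Omega_\zeta=R_{\pi/2}^{\zeta-5}\,\Omega_5\,R_{-\pi/2}^{\zeta-5}\quad(\zeta\in\{6,7,8\}),$$ and consider the kinetic scheme, with parameter $\omega\in[1,2]$ and time step $k=\Delta/\lambda$, for the 2D linear elastodynamics system with Maxwellians $\bar f_\zeta(q)=\begin{pmatrix}\Omega_\zeta&0\\0&\Omega_\zeta\end{pmatrix}q$, $q\in\mathbb{R}^6$, and initialization $f^0=\bar f(q^0)$. Then the numerical approximations $\big(\sum_\zeta f_{\zeta,l}\big)$ of $(\sqrt c\,\mathbb{F}^1_1,\sqrt c\,\mathbb{F}^1_2,u^1/\sqrt c)$ (with $l\in\{1,2,3\}$) and of $(\sqrt c\,\mathbb{F}^2_1,\sqrt c\,\mathbb{F}^2_2,u^2/\sqrt c)$ (with $l\in\{4,5,6\}$) are exactly the same as $R_{-\pi/2}$ applied to the approximations computed after rotating the initial conditions similarly. That is: for each of the two blocks of three components, let $r^0$ be the initial data on the grid and $r^n$ the numerical approximation at step $n$ (the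 sum over $\zeta$ of the corresponding three components of $f^n_\zeta$), and let $\tilde r^n$ be the numerical approximation at step $n$ computed from the rotated initial data $\tilde r^0(\boldsymbol{a})=R_{\pi/2}\,r^0(\rho^{-1}\boldsymbol{a})$; then $r^n(\boldsymbol{a})=R_{-\pi/2}\,\tilde r^n(\rho\,\boldsymbol{a})$ for all grid points $\boldsymbol{a}$ and all $n\ge0$.
   Context: Here $\rho=\begin{pmatrix}0&-1\\1&0\end{pmatrix}$ is the $\pi/2$-rotation of $\mathbb{R}^2$, $R_{\pi/2}\in\mathbb{R}^{3\times3}$ is the block matrix with upper-left $2\times2$ block $\rho$ and lower-right entry $1$ (other entries $0$), and $R_{-\pi/2}=R_{\pi/2}^{-1}$. D2Q5 speeds: $c_0=(0,0)$, $c_1=\lambda(1,0)$, $c_2=\lambda(0,1)$, $c_3=\lambda(-1,0)$, $c_4=\lambda(0,-1)$. D2Q9 speeds: these five together with $c_5=\lambda(1,1)$, $c_6=\lambda(-1,1)$, $c_7=\lambda(-1,-1)$, $c_8=\lambda(1,-1)$. The Cartesian grid is $\{(i\Delta,j\Delta):i,j\in\mathbb{Z}\}$ with $\Delta=k\lambda>0$. The kinetic scheme is $$f^{n+1}_{\zeta}(\boldsymbol{a}+kc_\zeta)=(1-\omega)f^n_{\zeta}(\boldsymbol{a})+\omega\,\bar f_{\zeta}\Big(\sum_{\zeta'}f^n_{\zeta'}(\boldsymbol{a})\Big)$$ for all grid points $\boldsymbol{a}$ and all $\zeta$, with $f^n_\zeta(\boldsymbol{a})\in\mathbb{R}^6$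 and $f^0_\zeta(\boldsymbol{a})=\bar f_\zeta(q^0(\boldsymbol{a}))$. The 2D linear elastodynamics system is $\partial_t\mathbb{F}^m_a-\partial_au^m=0$, $\partial_tu^m-c^2\sum_{a=1}^2\partial_a\mathbb{F}^m_a=0$ for $a,m\in\{1,2\}$, with constant $c>0$; it is symmetrized by the variable $q=(\sqrt c\,\mathbb{F}^1_1,\sqrt c\,\mathbb{F}^1_2,u^1/\sqrt c,\sqrt c\,\mathbb{F}^2_1,\sqrt c\,\mathbb{F}^2_2,u^2/\sqrt c)$. *)

(* Defs.v *)
From mathcomp Require Export all_boot all_order all_algebra.
From mathcomp Require Export reals.

Set Implicit Arguments.
Unset Strict Implicit.
Unset Printing Implicit Defensive.

Import Order.TTheory GRing.Theory Num.Theory.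
Local Open Scope ring_scope.

Section Defs.
Variable R : realType.

Definition vec2 (x y : R) : 'cV[R]_2 := \col_(i < 2) (if i == 0 then x else y).

Definition rho : 'M[R]_2 := row_mx (vec2 0 1) (vec2 (-1) 0) : 'M_(2, 1 + 1).

Definition Rpi2 : 'M[R]_3 := block_mx rho 0 0 1%:M : 'M_(2 + 1).

Definition d2q5_dirs : seq 'cV[R]_2 :=
  [:: vec2 0 0; vec2 1 0; vec2 0 1; vec2 (-1) 0; vec2 0 (-1)].

Definition d2q9_dirs : seq 'cV[R]_2 :=
  d2q5_dirs ++ [:: vec2 1 1; vec2 (-1) 1; vec2 (-1) (-1); vec2 1 (-1)].

(* Meaningful for Q = 5 and Q = 9 only. *)
Definition speed (Q : nat) (lam : R) (z : 'I_Q) : 'cV[R]_2 :=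
  lam *: nth 0 (if Q == 5%N then d2q5_dirs else d2q9_dirs) z.

(* "Positive" is read in the wide sense (nonnegative quadratic form), so that
   some of the matrices are allowed to be singular or zero. *)
Definition sym_positive n (A : 'M[R]_n) : Prop :=
  A^T = A /\ forall x : 'cV[R]_n, 0 <= (x^T *m A *m x) 0 0.

Definition on_grid (Delta : R) (a : 'cV[R]_2) : Prop :=
  exists i j : int, a = vec2 (i%:~R * Delta) (j%:~R * Delta).

(* The m-th block of three components of a state in R^6 = R^3 x R^3. *)
Definition state_block (m : 'I_2) (q : 'cV[R]_(3 + 3)) : 'cV[R]_3 :=
  if m == 0 then usubmx q else dsubmx q.

(* Symmetrizing variable of the elastodynamics system
     d_t F^m_a - d_a u^m = 0,   d_t u^m - c^2 sum_a d_a F^m_a = 0;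
   the entry F^m_a is [F m a], and u^m is [u m 0]. *)
Definition elastic_block (c : R) (F : 'M[R]_2) (u : 'cV[R]_2) (m : 'I_2) :
    'cV[R]_3 :=
  col_mx (vec2 (Num.sqrt c * F m 0) (Num.sqrt c * F m 1))
         (u m 0 / Num.sqrt c)%:M : 'cV_(2 + 1).

Definition elastic_var (c : R) (F : 'M[R]_2) (u : 'cV[R]_2) : 'cV[R]_(3 + 3) :=
  col_mx (elastic_block c F u 0) (elastic_block c F u 1).

Definition maxwellian (Q : nat) (Omega : 'I_Q -> 'M[R]_3) (z : 'I_Q)
    (q : 'cV[R]_(3 + 3)) : 'cV[R]_(3 + 3) :=
  block_mx (Omega z) 0 0 (Omega z) *m q.

Definition num_approx (Q : nat) (f : nat -> 'I_Q -> 'cV[R]_2 -> 'cV[R]_(3 + 3))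
    (n : nat) (a : 'cV[R]_2) : 'cV[R]_(3 + 3) :=
  \sum_(z < Q) f n z a.

(* [f n z a] is only constrained for [a] on the grid; since the grid is stable
   under translation by [k *: c z], the two clauses determine [f] there. *)
Definition kinetic_scheme (Q : nat) (Delta k omega : R) (c : 'I_Q -> 'cV[R]_2)
    (fbar : 'I_Q -> 'cV[R]_(3 + 3) -> 'cV[R]_(3 + 3))
    (q0 : 'cV[R]_2 -> 'cV[R]_(3 + 3))
    (f : nat -> 'I_Q -> 'cV[R]_2 -> 'cV[R]_(3 + 3)) : Prop :=
  (forall z a, on_grid Delta a -> f 0%N z a = fbar z (q0 a)) /\
  (forall n z a, on_grid Delta a ->
     f n.+1 z (a + k *: c z) =
     (1 - omega) *: f n z a + omega *: fbar z (num_approx f n a)).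

End Defs.

Arguments rho {R}.
Arguments Rpi2 {R}.

(* Main.v *)
(* The quarter turn permutes the speeds, c_(sigma z) = rho c_z, and conjugation
   by Rpi2 permutes the matrices Omega_z in the same way; for z = 0 this follows
   from the sum of all of them being the identity.  Hence the scheme is
   equivariant: ft^n_(sigma z) (rho a) = Rpi2 f^n_z (a), block by block, by
   induction on n, and summing over z gives the claim. *)
Require Import Defs.

Set Implicit Arguments.
Unset Strict Implicit.
Unset Printing Implicit Defensive.

Import Order.TTheory GRing.Theory Num.Theory.
Local Open Scope ring_scope.

Section Rotations.
Variable R : realType.

Lemma vec2_col_mx (x y : R) : vec2 x y = col_mx x%:M y%:M :> 'cV_(1 + 1).
Proof.
by apply/colP => i; rewrite !mxE -val_eqE /=; case: splitP => j ->; rewrite ord1 mxE.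
Qed.

Lemma scale_vec2 (a x y : R) : a *: vec2 x y = vec2 (a * x) (a * y).
Proof. by apply/colP => i; rewrite !mxE; case: ifP. Qed.

Lemma add_vec2 (x y x' y' : R) : vec2 x y + vec2 x' y' = vec2 (x + x') (y + y').
Proof. by apply/colP => i; rewrite !mxE; case: ifP. Qed.

Lemma rho_vec2 (x y : R) : rho *m vec2 x y = vec2 (- y) x.
Proof.
rewrite /rho [vec2 x y]vec2_col_mx (@mul_row_col _ 2 1 1 1) !mul_mx_scalar !scale_vec2.
by rewrite add_vec2 !mulr0 add0r mulrN1 mulr1 addr0.
Qed.

Lemma rho_sqr : rho *m rho = (-1)%:M :> 'M[R]_2.
Proof.
rewrite {2}/rho (@mul_mx_row _ 2 2 1 1) !rho_vec2.
apply/matrixP => i j; rewrite mxE.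
case: (splitP (j : 'I_(1 + 1))) => j' jE; rewrite ord1 !mxE -!val_eqE /= jE ord1;
  by case: i => [[|[|//]]] //= _; rewrite ?oppr0.
Qed.

Lemma rho_unit : (rho : 'M[R]_2) \is a GRing.unit.
Proof.
by apply/unitrP; exists (- rho); rewrite mulNr mulrN -mulmxE rho_sqr raddfN opprK.
Qed.

Lemma Rpi2_sqr : Rpi2 *m Rpi2 = block_mx (-1)%:M 0 0 1%:M :> 'M[R]_(2 + 1).
Proof.
by rewrite /Rpi2 (@mulmx_block _ 2 1 2 1 2 1) rho_sqr !mulmx0 !mul0mx mulmx1 !addr0 add0r.
Qed.

(** The square is [diag(-1, -1, 1)], an involution. Order four makes [Rpi2] invertible and later
    closes the orbits of conjugated matrices. *)
Lemma Rpi2_exp4 : Rpi2 ^+ 4 = 1 :> 'M[R]_3.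
Proof.
rewrite (exprM _ 2 2) !expr2 -!mulmxE Rpi2_sqr (@mulmx_block _ 2 1 2 1 2 1).
rewrite !mulmx0 !mul0mx mulmx1 !addr0 add0r -scalar_mxM mulrNN mulr1.
exact: (esym (@scalar_mx_block _ 2 1 1)).
Qed.

Lemma Rpi2_unit : (Rpi2 : 'M[R]_3) \is a GRing.unit.
Proof. by rewrite -(@unitrX_pos _ _ 4) // Rpi2_exp4 unitr1. Qed.

Lemma on_grid_rho (Delta : R) a : on_grid Delta a -> on_grid Delta (rho *m a).
Proof.
by case=> i [j ->]; exists (- j), i; rewrite rho_vec2 mulrNz mulNr.
Qed.

Lemma on_gridB (Delta : R) a b :
  on_grid Delta a -> on_grid Delta b -> on_grid Delta (a - b).
Proof.
case=> i [j ->] [i' [j' ->]]; exists (i - i'), (j - j').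
by rewrite -scaleN1r scale_vec2 add_vec2 !mulN1r !rmorphB !mulrBl.
Qed.

Lemma on_grid_speed (lam Delta : R) (Q : nat) (z : 'I_Q) :
  lam != 0 -> on_grid Delta (Delta / lam *: speed lam z).
Proof.
move=> lam_neq0; rewrite /speed scalerA divfK //; move: (nat_of_ord z) => {z} z.
have E (i j : int) : on_grid Delta (Delta *: vec2 i%:~R j%:~R).
  by exists i, j; rewrite scale_vec2 ![Delta * _]mulrC.
have E0 : on_grid Delta (Delta *: 0).
  by rewrite scaler0 -(subrr (Delta *: vec2 0 0)); apply: on_gridB; apply: (E 0 0).
(* The D2Q9 list extends the D2Q5 one, so its nine entries cover both speed sets. An index past the
   end yields the default vector [0], covered by [E0]. *)
have H : on_grid Delta (Delta *: nth 0 (d2q9_dirs R) z).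
  case: z => [|[|[|[|[|[|[|[|[|z]]]]]]]]] /=;
  [exact: (E 0 0)|exact: (E 1 0)|exact: (E 0 1)|exact: (E (-1) 0)|exact: (E 0 (-1))
  |exact: (E 1 1)|exact: (E (-1) 1)|exact: (E (-1) (-1))|exact: (E 1 (-1))|].
  by rewrite nth_nil.
case: ifP => // _; have [z5|z5] := ltnP z 5; last by rewrite nth_default.
by move: H; rewrite nth_cat z5.
Qed.

End Rotations.

Section Blocks.
Variable R : realType.
Implicit Types (m : 'I_2) (x y : 'cV[R]_(3 + 3)).

Lemma state_block_comb m a b x y :
  state_block m (a *: x + b *: y) = a *: state_block m x + b *: state_block m y.
Proof. by rewrite /state_block; case: ifP => _; rewrite linearP linearZ. Qed.

Lemma state_block_sum m I (r : seq I) (F : I -> 'cV[R]_(3 + 3)) :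
  state_block m (\sum_(i <- r) F i) = \sum_(i <- r) state_block m (F i).
Proof. by rewrite /state_block; case: ifP => _; rewrite linear_sum. Qed.

Lemma state_block_maxwellian m (Q : nat) (Omega : 'I_Q -> 'M[R]_3) z x :
  state_block m (maxwellian Omega z x) = Omega z *m state_block m x.
Proof.
rewrite /state_block /maxwellian -{1 2}[x]vsubmxK mul_block_col !mul0mx.
by rewrite addr0 add0r; case: ifP => _; rewrite ?col_mxKu ?col_mxKd.
Qed.

End Blocks.

Section Equivariance.
Variables (R : realType) (Q : nat) (Omega : 'I_Q -> 'M[R]_3).
Variable sigma : 'I_Q -> 'I_Q.
Hypothesis sigma_inj : injective sigma.

(** As [sigma] permutes the indices, summing either side over all of them gives [P]; cancelling the
    terms [z != z0] leaves the one at the fixed point. This serves the zero speed, about which the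
    rotation relations say nothing. *)
Lemma fixed_point_intertwining (P : 'M[R]_3) z0 :
    \sum_(z < Q) Omega z = 1%:M -> sigma z0 = z0 ->
    (forall z, z != z0 -> Omega (sigma z) *m P = P *m Omega z) ->
  Omega z0 *m P = P *m Omega z0.
Proof.
move=> Osum sz0 Oz.
have: (\sum_(z < Q) Omega (sigma z)) *m P = P *m \sum_(z < Q) Omega z.
  have <- : \sum_(z < Q) Omega z = \sum_(z < Q) Omega (sigma z).
    exact: reindex_inj sigma_inj.
  by rewrite Osum mul1mx mulmx1.
rewrite mulmx_suml mulmx_sumr (bigD1 z0) //= [in RHS](bigD1 z0) //= sz0.
by rewrite (eq_bigr _ Oz) => /addIr.
Qed.

Variables (Delta k omega : R) (c : 'I_Q -> 'cV[R]_2).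
Variables (q0 qt0 : 'cV[R]_2 -> 'cV[R]_(3 + 3)).
Variables (f ft : nat -> 'I_Q -> 'cV[R]_2 -> 'cV[R]_(3 + 3)) (m : 'I_2).
Hypothesis grid_c : forall z, on_grid Delta (k *: c z).
Hypothesis c_sigma : forall z, c (sigma z) = rho *m c z.
Hypothesis Omega_sigma : forall z, Omega (sigma z) *m Rpi2 = Rpi2 *m Omega z.
Hypothesis Hf : kinetic_scheme Delta k omega c (maxwellian Omega) q0 f.
Hypothesis Hft : kinetic_scheme Delta k omega c (maxwellian Omega) qt0 ft.
Hypothesis Hqt0 : forall a, on_grid Delta a ->
  state_block m (qt0 a) = Rpi2 *m state_block m (q0 (rho^-1 *m a)).

(** Reindexing by [sigma] passes from populations to their sum. This is used twice: inside the
    induction, for the equilibrium term, and for the final approximations. *)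
Let rotated_sum n a :
    (forall z, state_block m (ft n (sigma z) (rho *m a)) =
               Rpi2 *m state_block m (f n z a)) ->
  state_block m (num_approx ft n (rho *m a)) =
  Rpi2 *m state_block m (num_approx f n a).
Proof.
move=> H; rewrite !state_block_sum (reindex_inj sigma_inj) mulmx_sumr.
exact: eq_bigr.
Qed.

Lemma kinetic_scheme_rotated n z a : on_grid Delta a ->
  state_block m (ft n (sigma z) (rho *m a)) = Rpi2 *m state_block m (f n z a).
Proof.
elim: n z a => [|n IHn] z a ga.
  rewrite (proj1 Hf) // (proj1 Hft); last exact: on_grid_rho.
  rewrite !state_block_maxwellian Hqt0; last exact: on_grid_rho.
  by rewrite (mulKmx (rho_unit R)) !mulmxA Omega_sigma.
(* The scheme prescribes values at arrival points, so [a] is written as [b + k *: c z] with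
   departure node [b] on the grid. *)
have gb := on_gridB ga (grid_c z).
rewrite -(subrK (k *: c z) a); move: (a - _) gb => b gb.
(* The rotated arrival point is [rho *m b + k *: c (sigma z)], where the scheme for [ft] updates
   population [sigma z] from node [rho *m b]. *)
rewrite (proj2 Hf) // mulmxDr -scalemxAr -c_sigma (proj2 Hft); last first.
  exact: on_grid_rho.
rewrite !state_block_comb !state_block_maxwellian rotated_sum => [|y]; last first.
  exact: IHn.
by rewrite IHn // mulmxDr -!scalemxAr !mulmxA Omega_sigma.
Qed.

Lemma num_approx_rotated n a : on_grid Delta a ->
  state_block m (num_approx ft n (rho *m a)) =
  Rpi2 *m state_block m (num_approx f n a).
Proof. by move=> ga; apply: rotated_sum => z; apply: kinetic_scheme_rotated. Qed.

End Equivariance.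

(** The permutation with cycles (1 2 3 4) and (5 6 7 8) fixing 0. It preserves the indices below 5,
    so one table serves both speed sets. *)
Definition quarter_turn (z : nat) : nat :=
  nth 0%N [:: 0; 2; 3; 4; 1; 6; 7; 8; 5]%N z.

Section QuarterTurn.
Variables (R : realType) (Q : nat).
Hypothesis HQ : Q = 5%N \/ Q = 9%N.

Lemma quarter_turn_lt (z : 'I_Q) : (quarter_turn z < Q)%N.
Proof. by case: z => z; case: HQ => ->; do 9? [case: z => [|z] //=]. Qed.

Definition sigma (z : 'I_Q) : 'I_Q := Ordinal (quarter_turn_lt z).

Lemma sigma_inj : injective sigma.
Proof.
(* Injectivity is decided by computation on all pairs of indices below 9, which contains the range
   for either value of [Q]. *)
have H : all [pred x | all [pred y |
    (quarter_turn x == quarter_turn y) ==> (x == y)] (iota 0 9)] (iota 0 9).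
  by [].
have z9 (z : 'I_Q) : nat_of_ord z \in iota 0 9.
  by rewrite mem_iota (leq_trans (ltn_ord z)) //; case: HQ => ->.
move=> x y /(congr1 val) /= /eqP Exy; apply/val_inj/eqP.
by have /allP/(_ _ (z9 y)) := allP H _ (z9 x); rewrite /= Exy.
Qed.

Lemma speed_sigma (lam : R) z : speed lam (sigma z) = rho *m speed lam z.
Proof.
rewrite /speed -scalemxAr; congr (_ *: _); rewrite /sigma /=.
by move: (nat_of_ord z) (ltn_ord z) => {}z; case: HQ => -> /=;
  do 9? [case: z => [|z] //=]; move=> _;
  rewrite ?rho_vec2 ?oppr0 ?opprK.
Qed.

(** The last [Rpi2] cancels one inverse factor, so that conjugating once more becomes an
    intertwining relation. *)
Lemma conj_Rpi2_exp (A : 'M[R]_3) (j : nat) :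
  Rpi2 ^+ j.+1 *m A *m Rpi2^-1 ^+ j.+1 *m Rpi2 =
  Rpi2 *m (Rpi2 ^+ j *m A *m Rpi2^-1 ^+ j).
Proof.
by rewrite exprS exprSr !mulmxE -!mulrA mulVr ?Rpi2_unit // mulr1 !mulrA.
Qed.

Variable Omega : 'I_Q -> 'M[R]_3.

(* [Omega (s + j)] is [Omega s] conjugated [j] times, so conjugation cycles
   through the four of them because [Rpi2 ^+ 4 = 1]. *)
Lemma Omega_orbit (s : nat) (zs z : 'I_Q) :
    zs = s :> nat -> (s <= z <= s + 3)%N ->
    sigma z = (if z == s + 3 :> nat then s else z.+1)%N :> nat ->
    (forall y : 'I_Q, (s.+1 <= y <= s + 3)%N ->
       Omega y = Rpi2 ^+ (y - s) *m Omega zs *m Rpi2^-1 ^+ (y - s)) ->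
  Omega (sigma z) *m Rpi2 = Rpi2 *m Omega z.
Proof.
move=> Ezs /andP[sz zs3] Esz Orot.
have Oz : Omega z = Rpi2 ^+ (z - s) *m Omega zs *m Rpi2^-1 ^+ (z - s).
  (* [Orot] starts at [s + 1]; the index [s] itself is conjugation by the power 0. *)
  move: sz; rewrite leq_eqVlt => /orP[/eqP Es|sz]; last by rewrite Orot ?sz.
  rewrite -Es subnn !expr0 mulmx1 mul1mx; congr Omega.
  by apply: val_inj; rewrite /= Ezs.
rewrite Oz -conj_Rpi2_exp -subSn //; congr (_ *m _).
case: eqP Esz => [Ez|/eqP Ez] Esz.
  (* Wrap-around from [s + 3] to [s]: the exponent reaches 4, where the power is the identity. *)
  have -> : sigma z = zs by apply: val_inj; rewrite /= Ezs.
  by rewrite Ez -addnS addKn exprVn Rpi2_exp4 invr1 mulmx1 mul1mx.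
by rewrite Orot Esz // ltnS sz ltn_neqAle Ez.
Qed.

End QuarterTurn.

Theorem proposition5 (R : realType) (lam Delta omega c : R) (Q : nat)
  (Omega : 'I_Q -> 'M[R]_3)
  (lam_gt0 : 0 < lam) (Delta_gt0 : 0 < Delta)
  (omega_ge1 : 1 <= omega) (omega_le2 : omega <= 2) (c_gt0 : 0 < c)
  (HQ : Q = 5%N \/ Q = 9%N)
  (Omega_pos : forall z : 'I_Q, sym_positive (Omega z))
  (Omega_sum : \sum_(z < Q) Omega z = 1%:M)
  (Omega_rot4 : forall z1 z : 'I_Q, z1 = 1%N :> nat -> (2 <= z <= 4)%N ->
     Omega z = Rpi2 ^+ (z - 1) *m Omega z1 *m (Rpi2^-1) ^+ (z - 1))
  (Omega_rot8 : Q = 9%N ->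
     forall z5 z : 'I_Q, z5 = 5%N :> nat -> (6 <= z <= 8)%N ->
     Omega z = Rpi2 ^+ (z - 5) *m Omega z5 *m (Rpi2^-1) ^+ (z - 5))
  (F0 : 'cV[R]_2 -> 'M[R]_2) (u0 : 'cV[R]_2 -> 'cV[R]_2)
  (q0 qt0 : 'cV[R]_2 -> 'cV[R]_(3 + 3))
  (f ft : nat -> 'I_Q -> 'cV[R]_2 -> 'cV[R]_(3 + 3))
  (m : 'I_2)
  (Hq0 : forall a, on_grid Delta a -> q0 a = elastic_var c (F0 a) (u0 a))
  (Hf : kinetic_scheme Delta (Delta / lam) omega (@speed R Q lam)
          (maxwellian Omega) q0 f)
  (Hqt0 : forall a, on_grid Delta a ->
     state_block m (qt0 a) = Rpi2 *m state_block m (q0 (rho^-1 *m a)))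
  (Hft : kinetic_scheme Delta (Delta / lam) omega (@speed R Q lam)
           (maxwellian Omega) qt0 ft) :
  forall (n : nat) (a : 'cV[R]_2), on_grid Delta a ->
    state_block m (num_approx f n a) =
    Rpi2^-1 *m state_block m (num_approx ft n (rho *m a)).
Proof.
have Q_gt (i : nat) : (i < 5)%N -> (i < Q)%N.
  by move=> i5; apply: leq_trans i5 _; case: HQ => ->.
have Osigma (z : 'I_Q) : z != Ordinal (Q_gt 0%N isT) ->
    Omega (sigma HQ z) *m Rpi2 = Rpi2 *m Omega z.
  rewrite -val_eqE -lt0n /= => z_gt0.
  (* Nonzero indices up to 4 form the orbit of 1; larger ones occur only for [Q = 9] and form the
     orbit of 5. *)
  have [z4|z5] := leqP z 4.
    apply: (@Omega_orbit _ _ _ _ 1 (Ordinal (Q_gt 1%N isT))) => //.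
    - by rewrite z_gt0.
    - by case: (z) z_gt0 z4 => /= -[|[|[|[|[|]]]]].
    - by move=> y Hy; apply: Omega_rot4.
  have Q9 : Q = 9%N.
    by case: HQ => // Q5; move: (ltn_ord z); rewrite {2}Q5 ltnNge z5.
  have z9 : (z < 9)%N by apply: leq_trans (ltn_ord z) _; rewrite Q9.
  have lt5Q : (5 < Q)%N by rewrite Q9.
  apply: (@Omega_orbit _ _ _ _ 5 (Ordinal lt5Q)) => //.
  - by rewrite z5.
  - by case: (z) z5 z9 => /= -[|[|[|[|[|[|[|[|[|]]]]]]]]].
  - by move=> y Hy; apply: Omega_rot8.
have Omega_sigma z : Omega (sigma HQ z) *m Rpi2 = Rpi2 *m Omega z.
  have [->|/Osigma//] := eqVneq z (Ordinal (Q_gt 0%N isT)).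
  have s0 : sigma HQ (Ordinal (Q_gt 0%N isT)) = Ordinal (Q_gt 0%N isT).
    exact: val_inj.
  rewrite [in LHS]s0.
  exact: (fixed_point_intertwining (sigma_inj (HQ := HQ)) Omega_sum s0 Osigma).
move=> n a ga; rewrite (num_approx_rotated (sigma_inj (HQ := HQ)) _
  (speed_sigma HQ lam) Omega_sigma Hf Hft Hqt0) //.
  by rewrite (mulKmx (Rpi2_unit R)).
by move=> z; apply: on_grid_speed; rewrite gt_eqF.
Qed.
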